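(* Let $\mathbb{K}$ be a field and let $\mathcal{P}$ be a connected poset satisfying both of the following conditions: (A) $\mathcal{P}={\downarrow}\mathcal{T}$ for some finite $\mathcal{T}\subseteq\mathcal{P}$, and for all $\mathcal{A},\mathcal{B}\subseteq\mathcal{P}$ with $\mathcal{A}\cap\mathcal{B}\neq\emptyset$, each of the form ${\downarrow}p$ or ${\downarrow}p\cap{\uparrow}q$ with $p,q\in\mathcal{P}$, we have $\max(\mathcal{A}\cap\mathcal{B})\ne\emptyset$; (B) $\mathcal{P}={\uparrow}\mathcal{T}$ for some finite $\mathcal{T}\subseteq\mathcal{P}$, and for all $\mathcal{A},\mathcal{B}\subseteq\mathcal{P}$ with $\mathcal{A}\cap\mathcal{B}\neq\emptyset$, each of the form ${\uparrow}p$ or ${\uparrow}p\cap{\downarrow}q$ with $p,q\in\mathcal{P}$, we have $\min(\mathcal{A}\cap\mathcal{B})\ne\emptyset$. Then a connected subposet $\mathcal{S}^{\mathrm{rk}}$ of $\mathcal{P}$ can be constructed from $\mathcal{S}_\infty^{fin}$ and $\mathcal{S}_\infty^{init}$ as described in the context, and for any such $\mathcal{S}^{\mathrm{rk}}$, with embedding $F:\mathcal{S}^{\mathrm{rk}}\hookrightarrow\mathcal{P}$: (1) $\mathrm{mult}(\mathbb{K}_{\mathcal{P}},M)=\mathrm{mult}(\mathbb{K}_{\mathcal{S}^{\mathrm{rk}}},MF)$ for all functors $M:\mathcal{P}\to\mathrm{vect}_{\mathbb{K}}$; (2) if $\mathcal{Q}$ is a (not necessarily full) subposet of $\mathcal{P}$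 whose embedding $G:\mathcal{Q}\hookrightarrow\mathcal{P}$ is both final and initial, then every element of $\mathcal{S}^{\mathrm{rk}}$ is an element of $\mathcal{Q}$.
   Context: Notation: ${\uparrow}p=\{q: p\le q\}$, ${\downarrow}p=\{q:q\le p\}$, ${\uparrow}\mathcal{T}=\bigcup_{t\in\mathcal{T}}{\uparrow}t$, ${\downarrow}\mathcal{T}=\bigcup_{t\in\mathcal{T}}{\downarrow}t$; $\max$, $\min$ denote sets of maximal, minimal elements. A subposet of $\mathcal{P}$ is a subset with a partial order contained in that of $\mathcal{P}$; it is full if its order is the restriction of that of $\mathcal{P}$. A poset is connected if it is nonempty and any two elements are joined by a finite zigzag of comparable elements. Posets are viewed as categories. An embedding $G:\mathcal{Q}\hookrightarrow\mathcal{P}$ is final (resp. initial) if for every $p\in\mathcal{P}$ the set $\{q\in\mathcal{Q}:p\le q\text{ in }\mathcal{P}\}$ (resp. $\{q\in\mathcal{Q}:q\le p\text{ in }\mathcal{P}\}$), with the order of $\mathcal{Q}$, is nonempty and connected. $\mathcal{S}_\infty^{fin}$ is the full subposet $\bigcup_{n\ge0}\mathcal{S}_n$ of $\mathcal{P}$, where $\mathcal{S}_0=\max\mathcal{P}$ and $\mathcal{S}_n=\mathcal{S}_{n-1}\sqcup\max\{p\in\mathcal{P}:{\uparrow}p\cap\mathcal{S}_{n-1}\text{ is not connected}\}$ for $n\ge1$; it is the minimal full subposet whose embedding is final. Dually, $\mathcal{S}_\infty^{init}$ is the full subposet $\bigcup_{n\ge0}\mathcal{S}'_n$, where $\mathcal{S}'_0=\min\mathcal{P}$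 and $\mathcal{S}'_n=\mathcal{S}'_{n-1}\sqcup\min\{p\in\mathcal{P}:{\downarrow}p\cap\mathcal{S}'_{n-1}\text{ is not connected}\}$ for $n\ge1$; it is the minimal full subposet whose embedding is initial. Construction of $\mathcal{S}^{\mathrm{rk}}$: let $\mathcal{U}=\mathcal{S}_\infty^{fin}\cup\mathcal{S}_\infty^{init}$, with the partial order generated by the orders of the two full subposets $\mathcal{S}_\infty^{fin}$ and $\mathcal{S}_\infty^{init}$. If $\mathcal{U}$ is connected, put $\mathcal{S}^{\mathrm{rk}}=\mathcal{U}$. If $\mathcal{U}$ is disconnected, $\mathcal{S}^{\mathrm{rk}}$ has the same elements as $\mathcal{U}$, and its order is generated by that of $\mathcal{U}$ together with one order relation of $\mathcal{P}$ (in either direction) between an element of $\mathcal{S}_\infty^{init}$ and an element of $\mathcal{S}_\infty^{fin}$ (the choice is arbitrary); this turns $\mathcal{U}$ into a connected, not necessarily full, subposet of $\mathcal{P}$. $\mathrm{vect}_{\mathbb{K}}$ is the category of finite-dimensional $\mathbb{K}$-vector spaces; $MF=M\circ F$. For a connected poset $\mathcal{R}$, $\mathbb{K}_{\mathcal{R}}$ is the constant functor with value $\mathbb{K}$ and all maps identities; $\mathrm{mult}(\mathbb{K}_{\mathcal{R}},L)$ is the largest number $k$ such that $L\cong(\mathbb{K}_{\mathcal{R}})^{k}\oplus N$ for some functor $N:\mathcal{R}\to\mathrm{vect}_{\mathbb{K}}$. *)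

(* Defs.v *)
From HB Require Import structures.
From Stdlib Require Import Relation_Operators.
From mathcomp Require Import all_boot all_order all_algebra.
From mathcomp Require Import all_classical.

Set Implicit Arguments.
Unset Strict Implicit.
Unset Printing Implicit Defensive.

Import Order.TTheory GRing.Theory.

Local Open Scope classical_set_scope.
Local Open Scope order_scope.

(* The order of T as a Prop-valued relation. *)
Definition ple d (T : porderType d) (x y : T) : Prop := x <= y.

Definition upset d (T : porderType d) (p : T) : set T := [set q | p <= q].
Definition downset d (T : porderType d) (p : T) : set T := [set q | q <= p].

Definition upset_of d (T : porderType d) (A : set T) : set T :=
  \bigcup_(t in A) upset t.
Definition downset_of d (T : porderType d) (A : set T) : set T :=
  \bigcup_(t in A) downset t.

Definition max_elts d (T : porderType d) (A : set T) : set T :=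
  [set x | A x /\ forall y, A y -> x <= y -> y = x].
Definition min_elts d (T : porderType d) (A : set T) : set T :=
  [set x | A x /\ forall y, A y -> y <= x -> y = x].

(* The set A with the order R is connected: nonempty, and any two elements are
   joined by a zigzag of R-comparable elements, all lying in A. *)
Definition poset_connected (T : Type) (A : set T) (R : T -> T -> Prop) : Prop :=
  A !=set0 /\
  forall x y, A x -> A y ->
    clos_refl_sym_trans T (fun u v => [/\ A u, A v & R u v]) x y.

(* Not necessarily full subposets. The order is a relation on the ambient type
   that holds only between elements of the carrier; antisymmetry is inherited
   from T. *)
Record subposet d (T : porderType d) := Subposet {
  carrier : set T;
  sub_le : T -> T -> Prop;
  sub_le_sub : forall x y, sub_le x y -> [/\ carrier x, carrier y & x <= y];
  sub_le_refl : forall x, carrier x -> sub_le x x;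
  sub_le_trans : forall x y z, sub_le x y -> sub_le y z -> sub_le x z }.

Lemma sub_le_anti d (T : porderType d) (Q : subposet T) (x y : T) :
  sub_le Q x y -> sub_le Q y x -> x = y.
Proof.
move=> /sub_le_sub[_ _ xy] /sub_le_sub[_ _ yx].
by apply/le_anti; rewrite xy yx.
Qed.

Definition final_emb d (T : porderType d) (Q : subposet T) : Prop :=
  forall p : T, poset_connected [set q | carrier Q q /\ p <= q] (sub_le Q).
Definition initial_emb d (T : porderType d) (Q : subposet T) : Prop :=
  forall p : T, poset_connected [set q | carrier Q q /\ q <= p] (sub_le Q).

Lemma full_sub d (T : porderType d) (A : set T) (x y : T) :
  [/\ A x, A y & x <= y] -> [/\ A x, A y & x <= y].
Proof. by []. Qed.

Lemma full_refl d (T : porderType d) (A : set T) (x : T) :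
  A x -> [/\ A x, A x & x <= x].
Proof. by []. Qed.

Lemma full_trans d (T : porderType d) (A : set T) (x y z : T) :
  [/\ A x, A y & x <= y] -> [/\ A y, A z & y <= z] -> [/\ A x, A z & x <= z].
Proof. by move=> [Ax _ xy] [_ Az /(le_trans xy)]. Qed.

Definition full_subposet d (T : porderType d) (A : set T) : subposet T :=
  Subposet (@full_sub d T A) (@full_refl d T A) (@full_trans d T A).

Definition gen_le (T : Type) (A : set T) (R : T -> T -> Prop) (x y : T) : Prop :=
  [/\ A x, A y & clos_refl_trans T R x y].

Lemma gen_sub d (T : porderType d) (A : set T) (R : T -> T -> Prop)
    (hR : forall x y, R x y -> [/\ A x, A y & x <= y]) (x y : T) :
  gen_le A R x y -> [/\ A x, A y & x <= y].
Proof.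
move=> [Ax Ay xy]; split=> //.
by elim: xy => [u v /hR[]|u|u v w _ uv _ /(le_trans uv)].
Qed.

Lemma gen_refl (T : Type) (A : set T) (R : T -> T -> Prop) (x : T) :
  A x -> gen_le A R x x.
Proof. by move=> Ax; split=> //; apply: rt_refl. Qed.

Lemma gen_trans (T : Type) (A : set T) (R : T -> T -> Prop) (x y z : T) :
  gen_le A R x y -> gen_le A R y z -> gen_le A R x z.
Proof. by move=> [Ax _ xy] [_ Az yz]; split=> //; apply: rt_trans xy yz. Qed.

(* The subposet with elements A whose order is generated by R, that is, the
   smallest partial order on A containing R. *)
Definition gen_subposet d (T : porderType d) (A : set T) (R : T -> T -> Prop)
    (hR : forall x y, R x y -> [/\ A x, A y & x <= y]) : subposet T :=
  Subposet (gen_sub hR) (@gen_refl T A R) (@gen_trans T A R).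

(* The unions below are automatically disjoint: if p belongs to step m, then p is
   the least element of upset p `&` step m, which is therefore connected. *)
Fixpoint Sfin_step d (T : porderType d) (n : nat) : set T :=
  if n is m.+1 then
    @Sfin_step d T m `|`
    max_elts
      [set p | ~ poset_connected (upset p `&` @Sfin_step d T m) (@ple d T)]
  else max_elts [set: T].

Fixpoint Sinit_step d (T : porderType d) (n : nat) : set T :=
  if n is m.+1 then
    @Sinit_step d T m `|`
    min_elts
      [set p | ~ poset_connected (downset p `&` @Sinit_step d T m) (@ple d T)]
  else min_elts [set: T].

Definition Sfin d (T : porderType d) : subposet T :=
  full_subposet (\bigcup_n @Sfin_step d T n).
Definition Sinit d (T : porderType d) : subposet T :=
  full_subposet (\bigcup_n @Sinit_step d T n).

Lemma U_rel_sub d (T : porderType d) (x y : T) :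
  sub_le (Sfin T) x y \/ sub_le (Sinit T) x y ->
  [/\ (carrier (Sfin T) `|` carrier (Sinit T)) x,
      (carrier (Sfin T) `|` carrier (Sinit T)) y & x <= y].
Proof.
by case=> /sub_le_sub[? ? ?]; split=> //; by [left | right].
Qed.

Definition Uposet d (T : porderType d) : subposet T :=
  gen_subposet (@U_rel_sub d T).

Lemma add_rel_sub d (T : porderType d) (Q : subposet T) (a b : T)
    (Qa : carrier Q a) (Qb : carrier Q b) (ab : a <= b) (x y : T) :
  sub_le Q x y \/ (x = a /\ y = b) -> [/\ carrier Q x, carrier Q y & x <= y].
Proof. by case=> [/sub_le_sub|[-> ->]]. Qed.

Definition add_rel d (T : porderType d) (Q : subposet T) (a b : T)
    (Qa : carrier Q a) (Qb : carrier Q b) (ab : a <= b) : subposet T :=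
  gen_subposet (add_rel_sub Qa Qb ab).

(* The possible outcomes of the construction of S^rk. *)
Inductive is_Srk d (T : porderType d) : subposet T -> Prop :=
| Srk_connected :
    poset_connected (carrier (Uposet T)) (sub_le (Uposet T)) -> is_Srk (Uposet T)
| Srk_disconnected (a b : T) (Ua : carrier (Uposet T) a)
    (Ub : carrier (Uposet T) b) (ab : a <= b) :
    ~ poset_connected (carrier (Uposet T)) (sub_le (Uposet T)) ->
    (carrier (Sinit T) a /\ carrier (Sfin T) b) \/
    (carrier (Sfin T) a /\ carrier (Sinit T) b) ->
    is_Srk (add_rel Ua Ub ab).

Definition condA d (T : porderType d) : Prop :=
  (exists2 A : set T, finite_set A & [set: T] = downset_of A) /\
  forall A B : set T,
    (exists p : T, A = downset p \/ exists q : T, A = downset p `&` upset q) ->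
    (exists p : T, B = downset p \/ exists q : T, B = downset p `&` upset q) ->
    A `&` B !=set0 -> max_elts (A `&` B) !=set0.

Definition condB d (T : porderType d) : Prop :=
  (exists2 A : set T, finite_set A & [set: T] = upset_of A) /\
  forall A B : set T,
    (exists p : T, A = upset p \/ exists q : T, A = upset p `&` downset q) ->
    (exists p : T, B = upset p \/ exists q : T, B = upset p `&` downset q) ->
    A `&` B !=set0 -> min_elts (A `&` B) !=set0.

(* Functors from the poset (I, le), seen as a category, to finite-dimensional
   K-vector spaces. The laws quantify over all proofs of the inequalities, so
   that a map does not depend on the proof. *)
Record pfunctor (K : fieldType) (I : Type) (le : I -> I -> Prop) := PFunctor {
  fobj :> I -> vectType K;
  fmap : forall i j, le i j -> 'Hom(fobj i, fobj j);
  fmap_id : forall i (h : le i i), fmap h = \1%VF;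
  fmap_comp : forall i j k (hij : le i j) (hjk : le j k) (hik : le i k),
    fmap hik = (fmap hjk \o fmap hij)%VF }.

Definition piso (K : fieldType) (I : Type) (le : I -> I -> Prop)
    (L M : pfunctor K le) : Prop :=
  exists (f : forall i, 'Hom(L i, M i)) (g : forall i, 'Hom(M i, L i)),
    (forall i, cancel (f i) (g i) /\ cancel (g i) (f i)) /\
    (forall i j (h : le i j), (f j \o fmap L h = fmap M h \o f i)%VF).

Lemma pconst_id (K : fieldType) (I : Type) (le : I -> I -> Prop)
    (i : I) (h : le i i) :
  (\1%VF : 'Hom(K^o, K^o)) = \1%VF.
Proof. by []. Qed.

Lemma pconst_comp (K : fieldType) (I : Type) (le : I -> I -> Prop)
    (i j k : I) (hij : le i j) (hjk : le j k) (hik : le i k) :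
  (\1%VF : 'Hom(K^o, K^o)) = (\1 \o \1)%VF.
Proof. by rewrite comp_lfun1l. Qed.

Definition pconst (K : fieldType) (I : Type) (le : I -> I -> Prop) :
    pfunctor K le :=
  @PFunctor K I le (fun _ => K^o) (fun i j _ => \1%VF)
    (@pconst_id K I le) (@pconst_comp K I le).

Definition dsum_fun (K : fieldType) (V1 V2 W1 W2 : vectType K)
    (f : 'Hom(V1, W1)) (g : 'Hom(V2, W2)) (v : V1 * V2) : W1 * W2 :=
  (f v.1, g v.2).

Fact dsum_fun_linear (K : fieldType) (V1 V2 W1 W2 : vectType K)
    (f : 'Hom(V1, W1)) (g : 'Hom(V2, W2)) : linear (dsum_fun f g).
Proof. by move=> a u v; rewrite /dsum_fun /= !linearP. Qed.

HB.instance Definition _ (K : fieldType) (V1 V2 W1 W2 : vectType K)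
    (f : 'Hom(V1, W1)) (g : 'Hom(V2, W2)) :=
  GRing.isLinear.Build K (V1 * V2)%type (W1 * W2)%type _ (dsum_fun f g)
    (dsum_fun_linear f g).

Lemma dsum_id (K : fieldType) (I : Type) (le : I -> I -> Prop)
    (L N : pfunctor K le) (i : I) (h : le i i) :
  linfun (dsum_fun (fmap L h) (fmap N h)) = \1%VF.
Proof.
by apply/lfunP => -[u v]; rewrite !lfunE /= /dsum_fun /= !fmap_id !lfunE.
Qed.

Lemma dsum_comp (K : fieldType) (I : Type) (le : I -> I -> Prop)
    (L N : pfunctor K le) (i j k : I)
    (hij : le i j) (hjk : le j k) (hik : le i k) :
  linfun (dsum_fun (fmap L hik) (fmap N hik)) =
  (linfun (dsum_fun (fmap L hjk) (fmap N hjk)) \o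
   linfun (dsum_fun (fmap L hij) (fmap N hij)))%VF.
Proof.
apply/lfunP => -[u v]; rewrite comp_lfunE !lfunE /= /dsum_fun /=.
by rewrite (fmap_comp L hij hjk hik) (fmap_comp N hij hjk hik) !comp_lfunE.
Qed.

Definition pdsum (K : fieldType) (I : Type) (le : I -> I -> Prop)
    (L N : pfunctor K le) : pfunctor K le :=
  @PFunctor K I le (fun i => (L i * N i)%type)
    (fun i j h => linfun (dsum_fun (fmap L h) (fmap N h)))
    (@dsum_id K I le L N) (@dsum_comp K I le L N).

Definition pow_fun (K : fieldType) (k : nat) (V W : vectType K)
    (f : 'Hom(V, W)) (v : {ffun 'I_k -> V}) : {ffun 'I_k -> W} :=
  [ffun i => f (v i)].

Fact pow_fun_linear (K : fieldType) (k : nat) (V W : vectType K)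
    (f : 'Hom(V, W)) : linear (@pow_fun K k V W f).
Proof. by move=> a u v; apply/ffunP => i; rewrite !ffunE linearP. Qed.

HB.instance Definition _ (K : fieldType) (k : nat) (V W : vectType K)
    (f : 'Hom(V, W)) :=
  GRing.isLinear.Build K {ffun 'I_k -> V} {ffun 'I_k -> W} _
    (@pow_fun K k V W f) (@pow_fun_linear K k V W f).

Lemma ppow_id (K : fieldType) (I : Type) (le : I -> I -> Prop)
    (k : nat) (L : pfunctor K le) (i : I) (h : le i i) :
  linfun (@pow_fun K k _ _ (fmap L h)) = \1%VF.
Proof.
by apply/lfunP => v; rewrite !lfunE; apply/ffunP => x; rewrite ffunE fmap_id lfunE.
Qed.

Lemma ppow_comp (K : fieldType) (I : Type) (le : I -> I -> Prop)
    (k : nat) (L : pfunctor K le) (i j l : I)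
    (hij : le i j) (hjl : le j l) (hil : le i l) :
  linfun (@pow_fun K k _ _ (fmap L hil)) =
  (linfun (@pow_fun K k _ _ (fmap L hjl)) \o
   linfun (@pow_fun K k _ _ (fmap L hij)))%VF.
Proof.
apply/lfunP => v; rewrite comp_lfunE !lfunE; apply/ffunP => x.
by rewrite !ffunE (fmap_comp L hij hjl hil) comp_lfunE.
Qed.

(* The direct sum of k copies of L. *)
Definition ppow (K : fieldType) (I : Type) (le : I -> I -> Prop)
    (k : nat) (L : pfunctor K le) : pfunctor K le :=
  @PFunctor K I le (fun i => {ffun 'I_k -> L i})
    (fun i j h => linfun (@pow_fun K k _ _ (fmap L h)))
    (@ppow_id K I le k L) (@ppow_comp K I le k L).

Definition has_summand (K : fieldType) (I : Type) (le : I -> I -> Prop)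
    (L : pfunctor K le) (k : nat) : Prop :=
  exists N : pfunctor K le, piso L (pdsum (ppow k (pconst K le)) N).

Definition is_mult (K : fieldType) (I : Type) (le : I -> I -> Prop)
    (L : pfunctor K le) (k : nat) : Prop :=
  has_summand L k /\ forall k', has_summand L k' -> (k' <= k)%N.

(* The largest k with has_summand L k. The default value 0 of xget is never
   used when I is inhabited, by multP below. *)
Definition mult (K : fieldType) (I : Type) (le : I -> I -> Prop)
    (L : pfunctor K le) : nat :=
  xget 0%N [set k | is_mult L k].

Lemma has_summand_dim (K : fieldType) (I : Type) (le : I -> I -> Prop)
    (L : pfunctor K le) (i : I) (k : nat) :
  has_summand L k -> (k <= \dim {:L i})%N.
Proof.
move=> [N [f [g [fg _]]]]; have [_ gfK] := fg i.
have kg : lker (g i) == 0%VS by apply/lker0P; apply: can_inj gfK.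
have := dimvS (subvf (limg (g i))).
rewrite limg_dim_eq ?(eqP kg) ?capv0 // => /(leq_trans _); apply.
rewrite dimvf.
have -> : dim (pdsum (ppow k (pconst K le)) N i) = (#|'I_k| * 1 + dim (N i))%N.
  by [].
by rewrite card_ord muln1 leq_addr.
Qed.

Lemma has_summand0 (K : fieldType) (I : Type) (le : I -> I -> Prop)
    (L : pfunctor K le) : has_summand L 0.
Proof.
pose in2 i (v : L i) : {ffun 'I_0 -> K^o} * L i := (0%R, v).
pose out2 i (v : {ffun 'I_0 -> K^o} * L i) : L i := v.2.
have lin1 i : linear (in2 i).
  by move=> a u v; rewrite /in2; congr pair; apply/ffunP => -[].
have lin2 i : linear (out2 i) by [].
pose f1 i : {linear L i -> ({ffun 'I_0 -> K^o} * L i)%type} :=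
  HB.pack (in2 i) (GRing.isLinear.Build _ _ _ _ (in2 i) (lin1 i)).
pose f2 i : {linear ({ffun 'I_0 -> K^o} * L i)%type -> L i} :=
  HB.pack (out2 i) (GRing.isLinear.Build _ _ _ _ (out2 i) (lin2 i)).
exists L, (fun i => linfun (f1 i)), (fun i => linfun (f2 i)); split=> [i|i j h].
  split=> [v|u]; rewrite !lfunE // /in2 /out2 /=.
  by rewrite [RHS]surjective_pairing; congr pair; apply/ffunP => -[].
apply/lfunP => v; rewrite !comp_lfunE !lfunE /in2 /dsum_fun /=.
by congr pair; apply/ffunP => -[].
Qed.

Lemma multP (K : fieldType) (I : Type) (le : I -> I -> Prop)
    (L : pfunctor K le) (i : I) : is_mult L (mult L).
Proof.
apply: xgetPex.
have ex : exists k, `[< has_summand L k >].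
  by exists 0%N; apply/asboolP/has_summand0.
have ub k : `[< has_summand L k >] -> (k <= \dim {:L i})%N.
  by move=> /asboolP; apply: has_summand_dim.
case: (ex_maxnP ex ub) => k /asboolP Lk kmax; exists k; split=> // k' Lk'.
exact/kmax/asboolP.
Qed.

(* M o F for the embedding F of the subposet Q. *)
Definition sub_elt_le d (T : porderType d) (Q : subposet T) (x y : carrier Q) : Prop :=
  sub_le Q (val x) (val y).

Lemma sub_elt_leW d (T : porderType d) (Q : subposet T) (x y : carrier Q) :
  sub_elt_le x y -> val x <= val y.
Proof. by move=> /sub_le_sub[]. Qed.

Lemma prestrict_id (K : fieldType) d (T : porderType d) (Q : subposet T)
    (M : pfunctor K (@ple d T)) (x : carrier Q) (h : sub_elt_le x x) :
  fmap M (sub_elt_leW h) = \1%VF.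
Proof. exact: fmap_id. Qed.

Lemma prestrict_comp (K : fieldType) d (T : porderType d) (Q : subposet T)
    (M : pfunctor K (@ple d T)) (x y z : carrier Q)
    (xy : sub_elt_le x y) (yz : sub_elt_le y z) (xz : sub_elt_le x z) :
  fmap M (sub_elt_leW xz) =
  (fmap M (sub_elt_leW yz) \o fmap M (sub_elt_leW xy))%VF.
Proof. exact: fmap_comp. Qed.

Definition prestrict (K : fieldType) d (T : porderType d) (Q : subposet T)
    (M : pfunctor K (@ple d T)) : pfunctor K (@sub_elt_le d T Q) :=
  @PFunctor K (carrier Q) (@sub_elt_le d T Q) (fun x => M (val x))
    (fun x y h => fmap M (sub_elt_leW h))
    (@prestrict_id K d T Q M) (@prestrict_comp K d T Q M).

(* Main.v *)
Require Import Defs.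
From mathcomp Require Import all_boot all_order all_algebra.
From mathcomp Require Import all_classical.
From HB Require Import structures.
From Stdlib Require Import Relation_Operators.

(** The functor K^k is a summand of L iff there are k points x_b of lim L and
    k functionals phi_a on colim L with phi_a(x_b) the Kronecker delta.  Such
    data on S^rk is moved to the whole poset by extending the points from the
    initial subposet S^init and the functionals from the final subposet S^fin;
    connectedness of S^rk transports the pairing from one to the other.

    That S^fin is final rests on a measure: with T = down A for a finite A, let
    mu p be the number of elements of A above p.  If p is not connected at
    step n, two maximal elements s1, s2 are disconnected above p, and (A) lifts
    p to a maximal q below both; every element strictly above q misses one of
    s1, s2, so mu decreases.  By induction n < mu p, hence no p stays
    disconnected at all steps. *)

Set Implicit Arguments.
Unset Strict Implicit.
Unset Printing Implicit Defensive.

(* Both Defs and all_classical define fmap; this restores the former. *)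
Import Defs Order.TTheory GRing.Theory.

Local Open Scope classical_set_scope.
Local Open Scope order_scope.

(** * Zigzags and connectedness *)

Definition joined (T : Type) (A : set T) (R : T -> T -> Prop) : T -> T -> Prop :=
  clos_refl_sym_trans T (fun u v => [/\ A u, A v & R u v]).

Lemma joined_step (T : Type) (A : set T) (R : T -> T -> Prop) (x y : T) :
  A x -> A y -> R x y -> joined A R x y.
Proof. by move=> *; apply: rst_step. Qed.

Lemma joined_ind (T : Type) (A : set T) (R E : T -> T -> Prop) :
  (forall x, E x x) -> (forall x y, E x y -> E y x) ->
  (forall x y z, E x y -> E y z -> E x z) ->
  (forall x y, A x -> A y -> R x y -> E x y) ->
  forall x y, joined A R x y -> E x y.
Proof.
move=> Er Es Et ER x y; elim=> [u v [Au Av uv]|u|u v _|u v w _ uv _ vw].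
- exact: ER.
- exact: Er.
- exact: Es.
- exact: Et uv vw.
Qed.

Lemma joined_mono (T : Type) (A B : set T) (R S : T -> T -> Prop) (x y : T) :
  A `<=` B -> (forall u v, A u -> A v -> R u v -> S u v) ->
  joined A R x y -> joined B S x y.
Proof.
move=> AB RS; apply: joined_ind => [u|u v|u v w|u v Au Av uv].
- exact: rst_refl.
- exact: rst_sym.
- exact: rst_trans.
- by apply: joined_step; [apply: AB|apply: AB|apply: RS].
Qed.

Lemma poset_connected_flip (T : Type) (A : set T) (R : T -> T -> Prop) :
  poset_connected A (fun x y => R y x) <-> poset_connected A R.
Proof.
have flip S : poset_connected A (fun x y => S y x) -> poset_connected A S.
  move=> [A0 Aj]; split=> // x y Ax Ay; move: (Aj x y Ax Ay).
  apply: joined_ind => [u|u v|u v w|u v Au Av uv].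
  - exact: rst_refl.
  - exact: rst_sym.
  - exact: rst_trans.
  - by apply: rst_sym; apply: joined_step.
by split; [apply: flip|apply: (flip (fun x y => R y x))].
Qed.

Lemma poset_connected_least (T : Type) (A : set T) (R : T -> T -> Prop) (p : T) :
  A p -> (forall x, A x -> R p x) -> poset_connected A R.
Proof.
move=> Ap pR; split; first by exists p.
by move=> x y Ax Ay; apply: (@rst_trans _ _ _ p); [apply: rst_sym|];
  apply: joined_step => //; apply: pR.
Qed.

Lemma poset_connectedU (T : Type) (A B : set T) (R : T -> T -> Prop) (a b : T) :
  poset_connected A R -> poset_connected B R -> A a -> B b -> R a b \/ R b a ->
  poset_connected (A `|` B) R.
Proof.
move=> [_ Aj] [_ Bj] Aa Bb ab; split; first by exists a; left.
have ba : joined (A `|` B) R b a.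
  by case: ab => ab; [apply: rst_sym|]; apply: joined_step => //;
    solve [by left|by right].
have toa x : (A `|` B) x -> joined (A `|` B) R x a.
  case=> [Ax|Bx].
    by move: (Aj x a Ax Aa); apply: joined_mono => // u; left.
  apply: rst_trans ba.
  by move: (Bj x b Bx Bb); apply: joined_mono => // u; right.
by move=> x y /toa xa /toa ya; apply: rst_trans xa _; apply: rst_sym.
Qed.

(** Along a comparability in [A] the smaller fiber lies inside the larger one, which is connected,
    so points of the two fibers are joined. Composing such steps passes through a point of the
    middle fiber, which is nonempty. *)
Lemma poset_connected_fibers (T : Type) (A B : set T) (R S : T -> T -> Prop)
    (F : T -> set T) :
  (forall a, A a -> F a `<=` B /\ poset_connected (F a) S) ->
  (forall a a', A a -> A a' -> R a a' -> F a' `<=` F a) ->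
  B `<=` \bigcup_(a in A) F a ->
  poset_connected A R -> poset_connected B S.
Proof.
move=> FB Fanti BF [[a0 Aa0] Aj]; split.
  by have [sub [[x Fx] _]] := FB _ Aa0; exists x; apply: sub.
move=> x y /BF[a Aa Fx] /BF[b Ab Fy].
(* [joined] is reflexive outside [A] too, so the induction gives no membership for the middle point
   of a composite zigzag; the equivalence supplies it. *)
pose E u v := (A u <-> A v) /\
  (A u -> forall x y, F u x -> F v y -> joined B S x y).
have fib u x1 y1 : A u -> F u x1 -> F u y1 -> joined B S x1 y1.
  move=> Au Fx1 Fy1; have [sub [_ Fj]] := FB _ Au.
  by move: (Fj _ _ Fx1 Fy1); apply: joined_mono.
have : E a b.
  apply: (@joined_ind _ A R E) (Aj a b Aa Ab) => {a b Aa Ab x y Fx Fy}.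
  - by move=> u; split=> // Au x y; apply: fib.
  - move=> u v [uv Euv]; split; first by split=> /uv.
    by move=> /uv Au x y Fx Fy; apply: rst_sym; apply: Euv.
  - move=> u v w [uv Euv] [vw Evw]; split; first by rewrite uv.
    move=> Au x y Fx Fy; have Av : A v by apply/uv.
    have [_ [[z Fz] _]] := FB _ Av.
    by apply: (@rst_trans _ _ _ z); [apply: Euv|apply: Evw].
  - move=> u v Au Av uv; split=> // _ x y Fx Fy.
    by apply: (fib u) => //; apply: Fanti Fy.
by case=> _; apply.
Qed.

Lemma final_emb_connected d (T : porderType d) (Q : subposet T) :
  poset_connected [set: T] (@ple d T) -> final_emb Q ->
  poset_connected (carrier Q) (sub_le Q).
Proof.
move=> hT fQ; apply: (poset_connected_fibers
  (F := fun p => [set q | carrier Q q /\ p <= q]) _ _ _ hT).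
- by move=> p _; split=> // q [].
- by move=> p p' _ _ pp' q [Qq p'q]; split=> //; apply: le_trans pp' p'q.
- by move=> q Qq; exists q.
Qed.

(** * The subposet S^fin is final, and it lies in every final subposet *)

Section Final.
Variables (d : Order.disp_t) (T : porderType d).
Implicit Types (p q : T) (S : set T).

Let upcard (s : seq T) p := count (>= p) s.

Lemma upcard_le (s : seq T) p q : p <= q -> (upcard s q <= upcard s p)%N.
Proof. by move=> pq; apply: sub_count => t; apply: le_trans. Qed.

Lemma upcard_lt (s : seq T) p q t :
  p <= q -> t \in s -> p <= t -> ~~ (q <= t) -> (upcard s q < upcard s p)%N.
Proof.
move=> pq + pt qt; elim: s => //= u s IH; rewrite inE => /predU1P[<-|/IH lt].
  by rewrite pt (negbTE qt) add0n add1n ltnS upcard_le.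
rewrite -addnS leq_add //.
by case uq: (q <= u); rewrite ?(le_trans pq uq).
Qed.

Lemma Sfin_step0 n : max_elts [set: T] `<=` @Sfin_step d T n.
Proof. by elim: n => //= n IH p /IH; left. Qed.

Lemma Sfin_stepS n : @Sfin_step d T n `<=` @Sfin_step d T n.+1.
Proof. by move=> p; left. Qed.

(** A witness of disconnectedness. Its two points are maximal in [T], hence belong to every step, so
    the same pair can be kept while [p] moves up and [S] shrinks. *)
Let disc S p s1 s2 :=
  [/\ max_elts [set: T] s1, max_elts [set: T] s2, p <= s1, p <= s2 &
      ~ joined (upset p `&` S) (@ple d T) s1 s2].

Let nonconn S := [set p | ~ poset_connected (upset p `&` S) (@ple d T)].

Lemma discW S S' p q s1 s2 : S' `<=` S -> p <= q -> q <= s1 -> q <= s2 ->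
  disc S p s1 s2 -> disc S' q s1 s2.
Proof.
move=> S'S pq q1 q2 [m1 m2 _ _ nj]; split=> //; apply: contra_not nj.
by apply: joined_mono => // u [qu S'u]; split; [apply: le_trans pq qu|apply: S'S].
Qed.

Lemma disc_nonconn S p s1 s2 :
  max_elts [set: T] `<=` S -> disc S p s1 s2 -> nonconn S p.
Proof.
move=> S0 [m1 m2 p1 p2 nj] [_ cj]; apply/nj/cj; split=> //; exact: S0.
Qed.

Lemma nonconn_notin S p : nonconn S p -> ~ S p.
Proof.
move=> nS Sp; apply: nS; apply: (@poset_connected_least _ _ _ p).
  by split=> //; apply: lexx.
by move=> x [].
Qed.

Hypothesis hA : condA T.

Let tops_ex : exists s : seq T, forall p, exists2 t, t \in s & p <= t.
Proof.
case: hA => -[A /finite_seqP[s ->] AT] _; exists s => p.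
have : [set: T] p by [].
by rewrite AT => -[t ts pt]; exists t.
Qed.

Let tops : seq T := projT1 (cid tops_ex).

Lemma topsP p : exists2 t, t \in tops & p <= t.
Proof. exact: (projT2 (cid tops_ex)). Qed.

Let mu := upcard tops.

Lemma max_elts_tops p : max_elts [set: T] p -> p \in tops.
Proof.
move=> [_ pmax]; have [t ts pt] := topsP p.
by rewrite -(pmax t).
Qed.

(** Induction on [mu]: if a top [t] above [p] is not maximal, a point strictly above [t] no longer
    counts [t], so its measure is smaller. *)
Lemma max_elts_above p : exists2 m, max_elts [set: T] m & p <= m.
Proof.
elim: {p}(mu p).+1 {-2}p (ltnSn (mu p)) => // n IH p; rewrite ltnS => mup.
have [t ts pt] := topsP p.
have [tm|tnm] := pselect (max_elts [set: T] t); first by exists t.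
have [y [ty yt]] : exists y, t <= y /\ y <> t.
  apply: contra_notP tnm => ny; split=> // y _ ty.
  by apply: contrapT => yt; apply: ny; exists y.
have [|m mm ym] := IH y.
  apply: leq_trans mup; apply: (leq_trans _ (upcard_le tops pt)).
  apply: (upcard_lt ty ts) => //; apply/negP => yt'.
  by apply: yt; apply/le_anti; rewrite yt' ty.
by exists m => //; apply: le_trans pt (le_trans ty ym).
Qed.

(** Each point of [S] above [p] is comparable to a maximal element, which also lies in [S]. Hence
    the set is nonempty, and if it is disconnected, two maximal elements already show it. *)
Lemma nonconn_disc S p : max_elts [set: T] `<=` S -> nonconn S p ->
  exists s1 s2, disc S p s1 s2.
Proof.
move=> S0 ncp; apply: contra_notP ncp => nd.
have jm x : (upset p `&` S) x ->
    exists m, [/\ max_elts [set: T] m, p <= m &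
      joined (upset p `&` S) (@ple d T) x m].
  move=> [px Sx]; have [m mm xm] := max_elts_above x.
  have pm : p <= m by apply: le_trans px xm.
  exists m; split=> //; apply: joined_step => //.
  by split=> //; apply: S0.
split.
  by have [m mm pm] := max_elts_above p; exists m; split=> //; apply: S0.
move=> x y /jm[m [mm pm xm]] /jm[m' [mm' pm' ym']].
apply: rst_trans xm _; apply: rst_trans (rst_sym _ _ _ _ ym').
by apply: contrapT => nj; apply: nd; exists m, m'; split.
Qed.

Lemma disc_lift S p s1 s2 : disc S p s1 s2 ->
  exists q, [/\ p <= q, disc S q s1 s2 &
    forall q', q <= q' -> q' <> q -> (mu q' < mu q)%N].
Proof.
move=> D; have [m1 m2 p1 p2 _] := D.
(* The factor [upset p] in the first set keeps the maximal common lower bound above [p]. Since [s1]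
   and [s2] are entries of [tops], losing either one lowers [mu]. *)
have [|||q [[[q1 pq] q2] qmax]] := hA.2 (downset s1 `&` upset p) (downset s2).
- by exists s1; right; exists p.
- by exists s2; left.
- by exists p; do 2!split=> //; apply: lexx.
have Dq := discW (@subset_refl _ S) pq q1 q2 D.
exists q; split=> // q' qq' neq.
have [q'1|nq1] := boolP (q' <= s1); last first.
  exact: (upcard_lt qq' (max_elts_tops m1)).
have [q'2|nq2] := boolP (q' <= s2); last first.
  exact: (upcard_lt qq' (max_elts_tops m2)).
case: neq; apply: (qmax q') => //; split=> //; split=> //.
exact: le_trans pq qq'.
Qed.

Lemma nmax_gt S p : nonconn S p -> ~ max_elts (nonconn S) p ->
  exists q, [/\ nonconn S q, p <= q & q <> p].
Proof.
move=> np; apply: contra_notP => nq; split=> // q nonq pq.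
by apply: contrapT => qp; apply: nq; exists q.
Qed.

Lemma nonconn_step_mu n p : nonconn (@Sfin_step d T n) p -> (n < mu p)%N.
Proof.
elim: n p => [|n IH] p np.
  have [t ts pt] := topsP p.
  by rewrite -has_count; apply/hasP; exists t.
have [s1 [s2 /disc_lift[q [pq Dq lt]]]] := nonconn_disc (@Sfin_step0 _) np.
have nq : nonconn (@Sfin_step d T n) q.
  apply: (disc_nonconn (@Sfin_step0 _)).
  case: (Dq) => _ _ q1 q2 _.
  exact: (discW (@Sfin_stepS n) (lexx q) q1 q2 Dq).
(* A maximal such [q] would be added at step [n.+1], but a point disconnected at that step cannot
   belong to it. So some [q'] strictly above [q] is disconnected at step [n]. *)
have qm : ~ max_elts (nonconn (@Sfin_step d T n)) q.
  move=> qm; apply: (nonconn_notin (disc_nonconn (@Sfin_step0 _) Dq)).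
  by right.
have [q' [nq' qq' neq]] := nmax_gt nq qm.
apply: (leq_ltn_trans (IH q' nq')).
exact: (leq_trans (lt q' qq' neq) (upcard_le tops pq)).
Qed.

Lemma Sfin_final : final_emb (Sfin T).
Proof.
move=> p; pose S := carrier (Sfin T).
have S0 : max_elts [set: T] `<=` S by move=> x x0; exists 0%N.
have : poset_connected (upset p `&` S) (@ple d T).
  apply: contrapT => /(nonconn_disc S0)[s1 [s2 D]].
  (* A pair disconnected in the union is disconnected in each step; step [mu p] yields the
     contradiction [mu p < mu p]. *)
  have /nonconn_step_mu : nonconn (@Sfin_step d T (mu p)) p.
    apply: (disc_nonconn (@Sfin_step0 _)); case: (D) => _ _ p1 p2 _.
    by apply: discW (lexx p) p1 p2 D => x xS; exists (mu p).
  by rewrite ltnn.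
have AE : [set q | S q /\ p <= q] `<=>` upset p `&` S by split=> x [].
move=> [[z zS] cj]; split; first by exists z; apply: AE.2.
move=> x y /AE.1 Ax /AE.1 Ay; move: (cj x y Ax Ay).
apply: joined_mono; first by apply: AE.2.
by move=> u v [_ Su] [_ Sv] uv; split.
Qed.

(** If a point [p] added at step [n.+1] were not in [Q], all points of [Q] above it would be
    strictly above it, so by maximality of [p] their up-sets meet step [n] in connected sets. These
    are fibers over the connected set of points of [Q] above [p], and they cover because step [n]
    lies in [Q]; so [p] would be connected. *)
Lemma Sfin_min (Q : subposet T) : final_emb Q -> carrier (Sfin T) `<=` carrier Q.
Proof.
move=> fQ p [n _]; elim: n p => [|n IH] p /=.
  move=> [_ pmax]; have [[q [Qq pq]] _] := fQ p.
  by rewrite -(pmax q).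
move=> [/IH//|[np pmax]]; apply: contrapT => Qp; apply: np.
apply: (poset_connected_fibers
  (F := fun q => upset q `&` @Sfin_step d T n) _ _ _ (fQ p)).
- move=> q [Qq pq]; split.
    by move=> x [qx Sx]; split=> //; apply: le_trans pq qx.
  by apply: contrapT => /pmax/(_ pq) qp; apply: Qp; rewrite -qp.
- move=> q q' _ _ /sub_le_sub[_ _ qq'] x [q'x Sx]; split=> //.
  exact: le_trans qq' q'x.
- by move=> x [px Sx]; exists x; split=> //; [apply: IH|apply: lexx].
Qed.

End Final.

(** * Duality: the initial side as the final side of [T^d] *)

Lemma dual_sub d (T : porderType d) (Q : subposet T) (x y : T^d) :
  sub_le Q y x -> [/\ carrier Q x, carrier Q y & x <= y].
Proof. by move=> /sub_le_sub[]. Qed.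

Definition dual_subposet d (T : porderType d) (Q : subposet T) : subposet T^d :=
  @Subposet _ T^d (carrier Q) (fun x y => sub_le Q y x) (dual_sub (Q := Q))
    (@sub_le_refl _ _ Q) (fun x y z xy yz => sub_le_trans yz xy).

Lemma final_dual d (T : porderType d) (Q : subposet T) :
  final_emb (dual_subposet Q) <-> initial_emb Q.
Proof. by split=> iQ p; apply/poset_connected_flip; apply: iQ. Qed.

Lemma initial_dual d (T : porderType d) (Q : subposet T) :
  initial_emb (dual_subposet Q) <-> final_emb Q.
Proof. by split=> iQ p; apply/poset_connected_flip; apply: iQ. Qed.

Lemma Sinit_step_dual d (T : porderType d) n :
  @Sinit_step d T n = @Sfin_step _ T^d n.
Proof.
elim: n => //= n ->; congr (_ `|` _).
apply: (congr1 (@max_elts _ T^d)).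
by apply/seteqP; split=> p /= np /poset_connected_flip.
Qed.

Lemma Sinit_carrier d (T : porderType d) :
  carrier (Sinit T) = carrier (Sfin T^d).
Proof. by apply: eq_bigcupr => n _; rewrite Sinit_step_dual. Qed.

Lemma Sinit_initial d (T : porderType d) : condB T -> initial_emb (Sinit T).
Proof.
move=> hB; have E x : carrier (Sfin T^d) x <-> carrier (Sinit T) x.
  by rewrite Sinit_carrier.
(* [condB T] unfolds to [condA T^d]; the carriers agree only by a proved equality, which [E]
   transports. *)
have fT : final_emb (Sfin T^d) by apply: Sfin_final.
apply/final_dual => p; have [[q [/E Sq pq]] j] := fT p; split; first by exists q.
move=> x y [/E Sx px] [/E Sy py]; move: (j x y (conj Sx px) (conj Sy py)).
by apply: joined_mono => [u [/E Su pu]|u v _ _ [/E Su /E Sv uv]].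
Qed.

Lemma Sinit_min d (T : porderType d) (Q : subposet T) :
  initial_emb Q -> carrier (Sinit T) `<=` carrier Q.
Proof.
by rewrite Sinit_carrier => /final_dual/Sfin_min.
Qed.

(** * Existence and connectedness of S^rk *)

Lemma is_Srk_ex d (T : porderType d) :
  poset_connected [set: T] (@ple d T) -> condA T -> condB T ->
  exists S : subposet T, is_Srk S.
Proof.
move=> [[p _] _] hA hB.
have [uc|nc] := pselect
    (poset_connected (carrier (Uposet T)) (sub_le (Uposet T))).
  by exists (Uposet T); apply: Srk_connected.
(* A linking relation always exists: finality gives [b] above [p], initiality gives [a] below
   [p]. *)
have [[b [Sb pb]] _] := Sfin_final hA p.
have [[a [Sa ap]] _] := Sinit_initial hB p.
have Ua : carrier (Uposet T) a by right.
have Ub : carrier (Uposet T) b by left.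
exists (add_rel Ua Ub (le_trans ap pb)).
by apply: Srk_disconnected => //; left.
Qed.

Lemma gen_le_step (T : Type) (A : set T) (R : T -> T -> Prop) (x y : T) :
  A x -> A y -> R x y -> gen_le A R x y.
Proof. by move=> *; split=> //; apply: rt_step. Qed.

Lemma Uposet_le d (T : porderType d) (x y : T) :
  sub_le (Sfin T) x y \/ sub_le (Sinit T) x y -> sub_le (Uposet T) x y.
Proof. by move=> R; have [Ux Uy _] := U_rel_sub R; apply: gen_le_step. Qed.

Lemma add_rel_le d (T : porderType d) (Q : subposet T) (a b : T)
    (Qa : carrier Q a) (Qb : carrier Q b) (ab : a <= b) (x y : T) :
  sub_le Q x y \/ (x = a /\ y = b) -> sub_le (add_rel Qa Qb ab) x y.
Proof.
by move=> R; have [Qx Qy _] := add_rel_sub Qa Qb ab R; apply: gen_le_step.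
Qed.

Lemma is_Srk_carrier d (T : porderType d) (S : subposet T) :
  is_Srk S -> carrier S = carrier (Sfin T) `|` carrier (Sinit T).
Proof. by case. Qed.

Lemma is_Srk_le d (T : porderType d) (S : subposet T) (x y : T) :
  is_Srk S -> sub_le (Sfin T) x y \/ sub_le (Sinit T) x y -> sub_le S x y.
Proof.
case=> [_|a b Ua Ub ab _ _] /Uposet_le // xy.
by apply: add_rel_le; left.
Qed.

Lemma poset_connected_mono (T : Type) (A : set T) (R S : T -> T -> Prop) :
  (forall x y, R x y -> S x y) -> poset_connected A R -> poset_connected A S.
Proof.
move=> RS [A0 Aj]; split=> // x y Ax Ay; move: (Aj x y Ax Ay).
by apply: joined_mono => // u v _ _; apply: RS.
Qed.

(** Final and initial subposets of a connected poset are connected, so S^rk is a union of two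
    connected pieces. If [Uposet] is disconnected, the added relation bridges them. *)
Lemma is_Srk_connected d (T : porderType d) (S : subposet T) :
  poset_connected [set: T] (@ple d T) -> condA T -> condB T ->
  is_Srk S -> poset_connected (carrier S) (sub_le S).
Proof.
move=> hT hA hB SS; have leS x y := @is_Srk_le _ _ _ x y SS.
have cfin : poset_connected (carrier (Sfin T)) (sub_le S).
  apply: (poset_connected_mono (R := sub_le (Sfin T))).
    by move=> x y xy; apply: leS; left.
  exact/final_emb_connected/Sfin_final.
have cinit : poset_connected (carrier (Sinit T)) (sub_le S).
  apply: (poset_connected_mono (R := sub_le (Sinit T))).
    by move=> x y xy; apply: leS; right.
  apply/poset_connected_flip.
  apply: (final_emb_connected (Q := dual_subposet (Sinit T))).
    exact/poset_connected_flip.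
  exact/final_dual/Sinit_initial.
rewrite (is_Srk_carrier SS).
case: SS cfin cinit {leS} => [//|a b Ua Ub ab _ link] cfin cinit.
have Sab : sub_le (add_rel Ua Ub ab) a b by apply: add_rel_le; right.
case: link => -[Sa Sb].
  by apply: (poset_connectedU cfin cinit Sb Sa); right.
by apply: (poset_connectedU cfin cinit Sa Sb); left.
Qed.

(** * Extension of compatible families from an initial subposet *)

(* A compatible family is a point of the limit of X: limits may be computed over
   an initial subposet. *)
Lemma extend_section d (T : porderType d) (X : T -> Type)
    (tr : forall s t, s <= t -> X s -> X t)
    (trC : forall s t u (st : s <= t) (tu : t <= u) (su : s <= u) x,
      tr s u su x = tr t u tu (tr s t st x))
    (tr1 : forall s (ss : s <= s) x, tr s s ss x = x)
    (Q : subposet T) (x : forall s, carrier Q s -> X s) :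
  initial_emb Q ->
  (forall s t (Qs : carrier Q s) (Qt : carrier Q t) (st : s <= t),
    sub_le Q s t -> tr s t st (x s Qs) = x t Qt) ->
  exists2 x' : forall p, X p,
    forall s t (st : s <= t), tr s t st (x' s) = x' t &
    forall s (Qs : carrier Q s), x' s = x s Qs.
Proof.
move=> iQ xc.
(* The value transported to [p] is constant along zigzags of [Q] below [p], and initiality connects
   all points of [Q] there. *)
have indep p s t (Qs : carrier Q s) (Qt : carrier Q t) (sp : s <= p)
    (tp : t <= p) : tr s p sp (x s Qs) = tr t p tp (x t Qt).
  pose A := [set q | carrier Q q /\ q <= p].
  pose E s t := (A s <-> A t) /\
    forall (Qs : carrier Q s) (Qt : carrier Q t) (sp : s <= p) (tp : t <= p),
      tr s p sp (x s Qs) = tr t p tp (x t Qt).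
  have : E s t.
    have st : joined A (sub_le Q) s t by apply: (iQ p).2.
    move: st; apply: joined_ind => {s t Qs Qt sp tp}.
    - move=> s; split=> // Qs Qs' sp sp'.
      by rewrite (Prop_irrelevance Qs Qs') (bool_irrelevance sp sp').
    - by move=> s t [st Est]; split; [split=> /st|move=> *; rewrite Est].
    - move=> s t u [st Est] [tu Etu]; split; first by rewrite st.
      move=> Qs Qu sp up; have [Qt tp] : A t by apply/st.
      by rewrite (Est Qs Qt sp tp) Etu.
    - move=> s t As At st; split=> // Qs Qt sp tp.
      have [_ _ st'] := sub_le_sub st.
      by rewrite (trC _ _ _ st' tp sp) (xc _ _ Qs Qt).
  by case=> _; apply.
(* The chosen value is recorded together with its formula for every [s] of [Q] below [p], so that
   two points [s <= t] can be compared through one common [q] below both. *)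
have lift p : {v : X p | forall s (Qs : carrier Q s) (sp : s <= p),
    v = tr s p sp (x s Qs)}.
  apply: cid; have [[s [Qs sp]] _] := iQ p.
  by exists (tr s p sp (x s Qs)) => t Qt tp; apply: indep.
exists (fun p => projT1 (lift p)) => [s t st|s Qs].
  have [[q [Qq qs]] _] := iQ s.
  rewrite (projT2 (lift s) q Qq qs) (projT2 (lift t) q Qq (le_trans qs st)).
  by rewrite (trC _ _ _ qs st).
by rewrite (projT2 (lift s) s Qs (lexx s)) tr1.
Qed.

(** * Summands as dual systems of points and functionals *)

(** Points of the limit and functionals on the colimit are given pointwise, so no limit or colimit
    space, possibly of infinite dimension, has to be formed. *)
Definition splitting (K : fieldType) (I : Type) (le : I -> I -> Prop)
    (L : pfunctor K le) (k : nat) (x : 'I_k -> forall i, L i)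
    (phi : 'I_k -> forall i, 'Hom(L i, K^o)) : Prop :=
  [/\ forall a i j (h : le i j), fmap L h (x a i) = x a j,
      forall a i j (h : le i j), (phi a j \o fmap L h)%VF = phi a i &
      forall a b i, phi a i (x b i) = (a == b)%:R%R].

Section Summand.
Variables (K : fieldType) (I : Type) (le : I -> I -> Prop) (L : pfunctor K le).
Variable k : nat.
Local Open Scope ring_scope.

(** The points are the images of the standard basis vectors of K^k, the functionals the coordinates
    of the K^k component. *)
Lemma has_summand_splitting : has_summand L k ->
  exists x, exists phi, @splitting K I le L k x phi.
Proof.
move=> [N [f [g [fg fnat]]]].
(* [piso] asks for naturality of [f] only; that of the inverse follows. *)
have gnat i j (h : le i j) u :
    fmap L h (g i u) = g j (fmap (pdsum (ppow k (pconst K le)) N) h u).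
  have [_ gfK] := fg i; have [fgK _] := fg j.
  rewrite -{2}(gfK u) -[X in _ = g j X]comp_lfunE -fnat comp_lfunE.
  by rewrite fgK.
pose e (b : 'I_k) : {ffun 'I_k -> K^o} := [ffun a => (a == b)%:R].
have lin a i : linear (fun v : L i => (f i v).1 a : K^o).
  by move=> c u v; rewrite linearP /= !ffunE.
pose phi0 a i : {linear L i -> K^o} :=
  HB.pack (fun v : L i => (f i v).1 a : K^o)
    (GRing.isLinear.Build _ _ _ _ _ (lin a i)).
exists (fun b i => g i (e b, 0)), (fun a i => linfun (phi0 a i)).
split=> [b i j h|a i j h|a b i].
- rewrite gnat /= lfunE /= /dsum_fun /= linear0 lfunE /=.
  by congr (g j (_, _)); apply/ffunP => a; rewrite !ffunE lfunE.
- apply/lfunP => v; rewrite comp_lfunE !lfunE /=.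
  have /lfunP/(_ v) := fnat _ _ h; rewrite !comp_lfunE => ->.
  by rewrite lfunE /= lfunE /= ffunE lfunE.
- by rewrite lfunE /= (fg i).2 /= ffunE.
Qed.

(** The complement [N] is the common kernel of the functionals. The Kronecker relations make [pr] a
    projection onto it, and compatibility of [x] and [phi] makes the decomposition natural. *)
Lemma splitting_has_summand x phi :
  @splitting K I le L k x phi -> has_summand L k.
Proof.
move=> [xc phic phix].
have phiZ a b i (c : K) : phi a i (c *: x b i) = c * (a == b)%:R.
  by rewrite linearZ /= phix.
pose N0 i : {vspace L i} := (\bigcap_a lker (phi a i))%VS.
have N0P i v : reflect (forall a, phi a i v = 0) (v \in N0 i).
  rewrite memvE; apply: (iffP subv_bigcapP) => [H a|H a _].
    by apply/eqP; rewrite -memv_ker memvE; apply: H.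
  by rewrite -memvE memv_ker H.
have N0m i j (h : le i j) v : v \in N0 i -> fmap L h v \in N0 j.
  by move=> /N0P vN; apply/N0P => a; rewrite -comp_lfunE phic.
pose Nf i j (h : le i j) : 'Hom(subvs_of (N0 i), subvs_of (N0 j)) :=
  (linfun (vsproj (N0 j)) \o fmap L h \o linfun vsval)%VF.
have NfE i j h u : vsval (Nf i j h u) = fmap L h (vsval u).
  by rewrite !comp_lfunE !lfunE /= vsprojK ?N0m // subvsP.
have Nid i (h : le i i) : Nf i i h = \1%VF.
  by apply/lfunP => u; apply: subvs_inj; rewrite NfE fmap_id !lfunE.
have Ncomp i j l (hij : le i j) (hjl : le j l) (hil : le i l) :
    Nf i l hil = (Nf j l hjl \o Nf i j hij)%VF.
  apply/lfunP => u; apply: subvs_inj.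
  by rewrite comp_lfunE !NfE (fmap_comp L hij hjl hil) comp_lfunE.
pose N : pfunctor K le := PFunctor Nid Ncomp.
pose pr i (v : L i) : L i := v - \sum_a phi a i v *: x a i.
have prN i v : pr i v \in N0 i.
  apply/N0P => a; rewrite linearB linear_sum /= (bigD1 a) //=.
  rewrite phiZ eqxx mulr1 big1 ?addr0 ?subrr // => b ba.
  by rewrite phiZ eq_sym (negbTE ba) mulr0.
pose f0 i (v : L i) : {ffun 'I_k -> K^o} * subvs_of (N0 i) :=
  ([ffun a => phi a i v], vsproj (N0 i) (pr i v)).
pose g0 i (u : {ffun 'I_k -> K^o} * subvs_of (N0 i)) : L i :=
  \sum_a (u.1 a : K) *: x a i + vsval u.2.
have prlin i : linear (pr i).
  move=> c u v; rewrite /pr scalerBr addrACA -opprD scaler_sumr -big_split /=.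
  congr (_ - _); apply: eq_bigr => a _.
  by rewrite linearP scalerDl scalerA.
have flin i : linear (f0 i).
  move=> c u v; rewrite /f0 prlin linearP; congr (_, _).
  by apply/ffunP => a; rewrite !ffunE linearP.
have glin i : linear (g0 i).
  move=> c u v; rewrite /g0 scalerDr addrACA scaler_sumr -big_split /=.
  congr (_ + _); apply: eq_bigr => a _.
  by rewrite !ffunE scalerDl scalerA.
pose f1 i : {linear L i -> ({ffun 'I_k -> K^o} * subvs_of (N0 i))%type} :=
  HB.pack (f0 i) (GRing.isLinear.Build _ _ _ _ (f0 i) (flin i)).
pose g1 i : {linear ({ffun 'I_k -> K^o} * subvs_of (N0 i))%type -> L i} :=
  HB.pack (g0 i) (GRing.isLinear.Build _ _ _ _ (g0 i) (glin i)).
exists N, (fun i => linfun (f1 i)), (fun i => linfun (g1 i)).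
split=> [i|i j h]; first (split=> [v|[c u]]; rewrite !lfunE /=).
- rewrite /g0 /f0 /= vsprojK ?prN // /pr.
  by under eq_bigr do rewrite ffunE; rewrite addrC subrK.
- have phig a : phi a i (g0 i (c, u)) = c a.
    rewrite /g0 linearD linear_sum (bigD1 a) //= phiZ eqxx mulr1.
    rewrite big1 ?addr0 => [|b ba].
      by rewrite (N0P _ _ (subvsP u) a) addr0.
    by rewrite phiZ eq_sym (negbTE ba) mulr0.
  rewrite /f0; congr (_, _); first by apply/ffunP => a; rewrite ffunE phig.
  apply: subvs_inj; rewrite vsprojK ?prN // /pr.
  by under eq_bigr do rewrite phig; rewrite /g0 /= addrC addKr.
- apply/lfunP => v; rewrite !comp_lfunE !lfunE /= /dsum_fun /f0 /=.
  have phifm a : phi a j (fmap L h v) = phi a i v by rewrite -comp_lfunE phic.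
  congr (_, _).
    by rewrite lfunE; apply/ffunP => a; rewrite !ffunE lfunE phifm.
  apply: subvs_inj; rewrite NfE !vsprojK ?prN // /pr linearB.
  congr (_ - _); rewrite linear_sum; apply: eq_bigr => a _.
  by rewrite linearZ /= xc phifm.
Qed.

End Summand.

(** * Multiplicity under restriction to a connected subposet *)

Lemma mult_restrict (K : fieldType) d (T : porderType d)
    (S Q Q' : subposet T) (M : pfunctor K (@ple d T)) :
  poset_connected [set: T] (@ple d T) ->
  poset_connected (carrier S) (sub_le S) ->
  final_emb Q -> initial_emb Q' ->
  (forall x y, sub_le Q x y \/ sub_le Q' x y -> sub_le S x y) ->
  mult M = mult (prestrict S M).
Proof.
move=> hT hS fQ iQ' QS.
suff E k : has_summand M k <-> has_summand (prestrict S M) k.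
  rewrite /mult; congr (xget _ _); apply/seteqP.
  by split=> k [/E Lk kmax]; split=> // k' /E; apply: kmax.
split=> [/has_summand_splitting|/has_summand_splitting] [x [phi [xc phic phix]]].
  apply: (@splitting_has_summand _ _ _ (prestrict S M) _
    (fun a s => x a (val s)) (fun a s => phi a (val s))).
  by split=> [a i j h|a i j h|a b i]; [apply: xc|apply: phic|apply: phix].
have Qsub : carrier Q `<=` carrier S.
  by move=> s /sub_le_refl Qs; have [] := sub_le_sub (QS s s (or_introl Qs)).
have Q'sub : carrier Q' `<=` carrier S.
  by move=> s /sub_le_refl Qs; have [] := sub_le_sub (QS s s (or_intror Qs)).
pose el s (Ss : carrier S s) : carrier S := SigSub (mem_set Ss).
have elle s t (Ss : carrier S s) (St : carrier S t) :
  sub_le S s t -> sub_elt_le (el s Ss) (el t St) by [].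
have exx a : exists2 x' : forall p, M p,
    forall s t (st : ple s t), fmap M st (x' s) = x' t &
    forall s (Qs : carrier Q' s), x' s = x a (el s (Q'sub s Qs)).
  apply: (extend_section (X := fun p => M p)
    (tr := fun s t (st : s <= t) => fmap M (st : ple s t))) => //.
  - by move=> s t u st tu su y; rewrite (fmap_comp M st tu su) comp_lfunE.
  - by move=> s ss y; rewrite fmap_id lfunE.
  - move=> s t Qs Qt st Qst.
    have Sst : sub_le S s t by apply: QS; right.
    rewrite -(xc a _ _ (elle s t (Q'sub s Qs) (Q'sub t Qt) Sst)) /=.
    by congr (fmap M _ _); apply: Prop_irrelevance.
(* Functionals pull back along the maps of [M], so they form a covariant system on [T^d], where the
   final [Q] becomes initial and [extend_section] applies again. *)
have exphi a : exists2 phi' : forall p, 'Hom(M p, K^o),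
    forall s t (st : ple s t), (phi' t \o fmap M st)%VF = phi' s &
    forall s (Qs : carrier Q s), phi' s = phi a (el s (Qsub s Qs)).
  have [||||phi' phi'c phi'E] := @extend_section _ T^d
    (fun p => 'Hom(M p, K^o))
    (fun s t (st : @ple d T t s) f => (f \o fmap M st)%VF)
    _ _ (dual_subposet Q) (fun s Qs => phi a (el s (Qsub s Qs))).
  - by move=> s t u st tu su f; rewrite (fmap_comp M tu st su) comp_lfunA.
  - by move=> s ss f; rewrite fmap_id comp_lfun1r.
  - exact/initial_dual.
  - move=> s t Qs Qt st Qst.
    have Sst : sub_le S t s by apply: QS; left.
    rewrite -(phic a _ _ (elle t s (Qsub t Qt) (Qsub s Qs) Sst)) /=.
    by congr (_ \o fmap M _)%VF; apply: Prop_irrelevance.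
  exists phi' => // s t st; exact: (phi'c t s st).
pose x' a := projT1 (cid2 (exx a)); pose phi' a := projT1 (cid2 (exphi a)).
have x'c a s t (st : ple s t) : fmap M st (x' a s) = x' a t.
  by rewrite /x'; case: (cid2 (exx a)).
have x'E a s (Qs : carrier Q' s) : x' a s = x a (el s (Q'sub s Qs)).
  by rewrite /x'; case: (cid2 (exx a)).
have phi'c a s t (st : ple s t) : (phi' a t \o fmap M st)%VF = phi' a s.
  by rewrite /phi'; case: (cid2 (exphi a)).
have phi'E a s (Qs : carrier Q s) : phi' a s = phi a (el s (Qsub s Qs)).
  by rewrite /phi'; case: (cid2 (exphi a)).
have [[p0 _] _] := hT.
have [[q [Qq _]] _] := fQ p0; have [[q' [Qq' _]] _] := iQ' p0.
(* The two extensions agree with the given data only on Q' and Q respectively;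
   the pairing is carried from Q' to Q along zigzags of S. *)
have pairS a b s (Ss : carrier S s) :
    phi a (el s Ss) (x' b s) = (a == b)%:R%R.
  pose E s t := (carrier S s <-> carrier S t) /\
    forall (Ss : carrier S s) (St : carrier S t),
    phi a (el s Ss) (x' b s) = phi a (el t St) (x' b t).
  (* The pairing is constant along [S], as [phi] is compatible on [S] and [x'] everywhere; at [q']
     in [Q'] the family [x'] equals [x], which gives the Kronecker delta. *)
  have : E s q'.
    have j : joined (carrier S) (sub_le S) s q' by apply: hS.2 => //; apply: (Q'sub q').
    move: j; apply: joined_ind => {s Ss}.
    - by move=> s; split=> // Ss Ss'; rewrite (Prop_irrelevance Ss Ss').
    - by move=> s t [st Est]; split; [split=> /st|move=> *; rewrite Est].
    - move=> s t u [st Est] [tu Etu]; split; first by rewrite st.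
      move=> Ss Su; have St : carrier S t by apply/st.
      by rewrite (Est Ss St) Etu.
    - move=> s t Ss St st; split=> // Ss' St'.
      rewrite -(phic a _ _ (elle s t Ss' St' st)) comp_lfunE /=.
      by rewrite [fmap _ _ _]x'c.
  case=> _ /(_ Ss (Q'sub q' Qq')) ->.
  by rewrite x'E phix.
apply: (splitting_has_summand (x := x') (phi := phi')); split=> //.
move=> a b p.
(* Both extensions are compatible on all of [T], so connectedness moves the pairing to [q] in [Q],
   where [phi'] equals [phi] and [pairS] applies. *)
have : phi' a p (x' b p) = phi' a q (x' b q).
  have j : joined [set: T] (@ple d T) p q by apply: hT.2.
  move: j; apply: (@joined_ind _ _ _
    (fun p q => phi' a p (x' b p) = phi' a q (x' b q))) => //.
  - by move=> s t u -> ->.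
  - by move=> s t _ _ st; rewrite -(phi'c a s t st) comp_lfunE x'c.
by move=> ->; rewrite (phi'E a q Qq); apply: pairS.
Qed.

(** * Existence, equality of multiplicities and minimality for S^rk *)

Theorem mainTheorem7 (K : fieldType) (d : Order.disp_t) (T : porderType d)
    (hT : poset_connected [set: T] (@ple d T))
    (hA : condA T) (hB : condB T) :
  (exists S : subposet T, is_Srk S) /\
  forall S : subposet T, is_Srk S ->
    [/\ poset_connected (carrier S) (sub_le S),
        forall M : pfunctor K (@ple d T), mult M = mult (prestrict S M)
      & forall Q : subposet T, final_emb Q -> initial_emb Q ->
          carrier S `<=` carrier Q].
Proof.
split=> [|S SS]; first exact: is_Srk_ex.
have cS := is_Srk_connected hT hA hB SS; split=> // [M|Q fQ iQ].
  apply: (mult_restrict _ hT cS (Sfin_final hA) (Sinit_initial hB)).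
  by move=> x y; apply: is_Srk_le.
by rewrite (is_Srk_carrier SS) => p [|]; [apply: Sfin_min|apply: Sinit_min].
Qed.
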